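(* Let $d=2$ and let $Z_{\tau\in[0,T]}$ be the Markovian Bernstein process in $\mathbb R^2$ (in the sense recalled in the context) associated with the system $$\partial_t u=\tfrac12\Delta_{\mathsf x}u-\tfrac{|\mathsf x|^2}{2}u\ \text{ on }\mathbb R^2\times(0,T],\quad u(\cdot,0)=\mathcal N\varphi_0,$$ $$-\partial_t v=\tfrac12\Delta_{\mathsf x}v-\tfrac{|\mathsf x|^2}{2}v\ \text{ on }\mathbb R^2\times[0,T),\quad v(\cdot,T)=\mathcal N\psi_T,$$ with $\varphi_0=\psi_T=\delta_0$ the Dirac measure at the origin. Let $$\rho(t)=\frac{\sinh(t)\sinh(T-t)}{\sinh(T)},\qquad t\in[0,T],$$ and $A_{R_1,R_2}=\{\mathsf x\in\mathbb R^2: R_1\le|\mathsf x|<R_2\}$. Then the following statements hold: (a) If $0=R_1<R_2$ one has $\mathbb P_\mu(Z_0\in A_{0,R_2})=\mathbb P_\mu(Z_T\in A_{0,R_2})=1$. Moreover, the function $t\mapsto\mathbb P_\mu(Z_t\in A_{0,R_2})$ is monotone decreasing on $[0,\frac T2]$ and monotone increasing on $[\frac T2,T]$, thereby taking the minimal value $$\mathbb P_\mu(Z_{T/2}\in A_{0,R_2})=1-\exp\left[-\frac{R_2^2}{2\rho(T/2)}\right].$$ (b) If $1\le R_1<R_2$ one has $\mathbb P_\mu(Z_0\in A_{R_1,R_2})=\mathbb P_\mu(Z_T\in A_{R_1,R_2})=0$. Moreover, the function $t\mapsto\mathbb P_\mu(Z_t\in A_{R_1,R_2})$ is monotone increasing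 on $[0,\frac T2]$ and monotone decreasing on $[\frac T2,T]$, thereby taking the maximal value $$\mathbb P_\mu(Z_{T/2}\in A_{R_1,R_2})=\exp\left[-\frac{R_1^2}{2\rho(T/2)}\right]-\exp\left[-\frac{R_2^2}{2\rho(T/2)}\right].$$
   Context: $T>0$ is arbitrary. The Green's function of the system (in dimension $d$, here $d=2$) is Mehler's kernel $$g(\mathsf x,t,\mathsf y)=(2\pi\sinh t)^{-d/2}\exp\left[-\frac{\cosh(t)(|\mathsf x|^2+|\mathsf y|^2)-2(\mathsf x,\mathsf y)_{\mathbb R^d}}{2\sinh t}\right],\quad t>0.$$ The constant $\mathcal N>0$ is fixed by the normalization $\mathcal N^2\int_{\mathbb R^d\times\mathbb R^d}\varphi_0(d\mathsf x)g(\mathsf x,T,\mathsf y)\psi_T(d\mathsf y)=1$, i.e. $\mathcal N^2 g(\mathsf o,T,\mathsf o)=1$, where $\mathsf o$ is the origin, and $\mu(d\mathsf x,d\mathsf y)=\mathcal N^2\varphi_0(d\mathsf x)g(\mathsf x,T,\mathsf y)\psi_T(d\mathsf y)$ is the corresponding probability measure on $\mathbb R^d\times\mathbb R^d$. The solutions are $u(\mathsf x,t)=\mathcal N g(\mathsf x,t,\mathsf o)$ for $t\in(0,T]$ and $v(\mathsf x,t)=\mathcal N g(\mathsf x,T-t,\mathsf o)$ for $t\in[0,T)$. An $\mathbb R^d$-valued process $Z_{\tau\in[0,T]}$ is a Bernstein process if $\mathbb E(f(Z_r)\mid\mathcal F_s^+\vee\mathcal F_t^-)=\mathbb E(f(Z_r)\mid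 Z_s,Z_t)$ for every bounded Borel $f:\mathbb R^d\to\mathbb R$ and all $r\in(s,t)\subset[0,T]$, where $\mathcal F_s^+=\sigma(Z_\tau:\tau\le s)$ and $\mathcal F_t^-=\sigma(Z_\tau:\tau\ge t)$. The Bernstein process associated with the system is the Markovian Bernstein process on a probability space $(\Omega,\mathcal F,\mathbb P_\mu)$ such that: (i) $(Z_0,Z_T)$ has law $\mu$; (ii) for $n\ge2$, $0<t_1<\dots<t_n<T$ and Borel sets $F_1,\dots,F_n$, $$\mathbb P_\mu(Z_{t_1}\in F_1,\dots,Z_{t_n}\in F_n)=\int_{F_1}d\mathsf x_1\cdots\int_{F_n}d\mathsf x_n\prod_{k=2}^n g(\mathsf x_k,t_k-t_{k-1},\mathsf x_{k-1})\,u(\mathsf x_1,t_1)v(\mathsf x_n,t_n);$$ (iii) for every Borel set $F$, $\mathbb P_\mu(Z_t\in F)=\int_F u(\mathsf x,t)v(\mathsf x,t)\,d\mathsf x$ for $t\in(0,T)$, $\mathbb P_\mu(Z_0\in F)=\mathcal N\int_F v(\mathsf x,0)\,\delta_0(d\mathsf x)$ and $\mathbb P_\mu(Z_T\in F)=\mathcal N\int_F u(\mathsf x,T)\,\delta_0(d\mathsf x)$. *)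

(* Defs.v *)
From HB Require Import structures.
From mathcomp Require Import all_boot all_order all_algebra.
From mathcomp Require Import all_classical all_reals all_analysis.
From mathcomp Require Import measurable_realfun ring lra.

Set Implicit Arguments.
Unset Strict Implicit.
Unset Printing Implicit Defensive.

Import Order.TTheory GRing.Theory Num.Theory.
Import numFieldNormedType.Exports.

Local Open Scope classical_set_scope.
Local Open Scope ring_scope.

Definition sinh {R : realType} (t : R) : R := (expR t - expR (- t)) / 2.
Definition cosh {R : realType} (t : R) : R := (expR t + expR (- t)) / 2.

(* The library's norm on a product is the sup norm, hence [dot] and [enorm]. *)
Notation plane R := (measurableTypeR R * measurableTypeR R)%type.
Notation leb2 := (lebesgue_measure \x lebesgue_measure)%E.

Definition dot {R : realType} (x y : plane R) : R := x.1 * y.1 + x.2 * y.2.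
Definition enorm {R : realType} (x : plane R) : R := Num.sqrt (dot x x).

Definition annulus {R : realType} (r1 r2 : R) : set (plane R) :=
  [set x | r1 <= enorm x /\ enorm x < r2].

Section Hyperbolic.
Context {R : realType}.

Lemma sinh_gt0 (t : R) : 0 < t -> 0 < sinh t.
Proof.
move=> t0; rewrite /sinh divr_gt0// subr_gt0 ltr_expR; lra.
Qed.

Lemma cosh_sqr (t : R) : cosh t ^+ 2 = 1 + sinh t ^+ 2.
Proof.
have := expRxMexpNx_1 t; rewrite /cosh /sinh => h.
suff -> : ((expR t + expR (- t)) / 2) ^+ 2 =
  expR t * expR (- t) + ((expR t - expR (- t)) / 2) ^+ 2 by rewrite h.
by field.
Qed.

Lemma is_derive_sinh (t : R) : is_derive t 1 sinh (cosh t).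
Proof.
rewrite /sinh; apply: is_derive_eq.
by rewrite /cosh /GRing.scale/=; ring.
Qed.

Lemma is_derive_cosh (t : R) : is_derive t 1 cosh (sinh t).
Proof.
rewrite /cosh; apply: is_derive_eq.
by rewrite /sinh /GRing.scale/=; ring.
Qed.

Lemma is_derive_gauss (a b c x : R) :
  is_derive x 1 (fun z : R => expR (a * z ^+ 2 + b * z + c))
    ((2 * a * x + b) * expR (a * x ^+ 2 + b * x + c)).
Proof.
apply: (@is_derive_eq _ _ _ _ _ _ _ _ (is_derive1_comp (f := expR)
  (g := fun z : R => a * z ^+ 2 + b * z + c) _ _)).
by rewrite /GRing.scale/=; ring.
Qed.

Lemma derive2_gauss (k a b c x : R) :
  derive1n 2 (fun z : R => k * expR (a * z ^+ 2 + b * z + c)) x =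
  k * (2 * a + (2 * a * x + b) ^+ 2) * expR (a * x ^+ 2 + b * x + c).
Proof.
rewrite /derive1n /=.
have -> : (fun z : R => k * expR (a * z ^+ 2 + b * z + c))^`()%classic =
   (fun z => k * ((2 * a * z + b) * expR (a * z ^+ 2 + b * z + c))).
  apply/funext => z; rewrite derive1E; apply: (@derive_val _ _ _ _ _ _ _).
  have := is_derive_gauss a b c z => ?.
  by apply: is_derive_eq; rewrite /GRing.scale/=; ring.
rewrite derive1E; apply: (@derive_val _ _ _ _ _ _ _).
have := is_derive_gauss a b c x => ?.
by apply: is_derive_eq; rewrite /GRing.scale/=; ring.
Qed.

End Hyperbolic.

Section System.
Context {R : realType}.
Implicit Types (x y : plane R) (t : R).

(* Mehler's kernel in dimension 2, where (2 pi sinh t)^(-d/2) is an inverse. *)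
Definition mehler x t y : R :=
  (2 * pi * sinh t)^-1 *
  expR (- ((cosh t * (dot x x + dot y y) - 2 * dot x y) / (2 * sinh t))).

Definition laplacian (f : plane R -> R) x : R :=
  derive1n 2 (fun a : R => f (a, x.2)) x.1 +
  derive1n 2 (fun b : R => f (x.1, b)) x.2.

Definition solves_forward (u : plane R -> R -> R) (D : set R) : Prop :=
  forall x t, D t -> is_derive t 1 (u x)
    (2^-1 * laplacian (u ^~ t) x - dot x x / 2 * u x t).

Definition solves_backward (v : plane R -> R -> R) (D : set R) : Prop :=
  forall x t, D t -> is_derive t 1 (v x)
    (- (2^-1 * laplacian (v ^~ t) x - dot x x / 2 * v x t)).

Lemma mehler_solves_forward N y :
  solves_forward (fun x t => N * mehler x t y) [set t | 0 < t].
Proof.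
move=> x t /= t0.
have S0 := sinh_gt0 t0.
have S1 : sinh t != 0 by rewrite gt_eqF.
have p0 : (pi : R) != 0 by rewrite gt_eqF// pi_gt0.
have CS := cosh_sqr t.
have dS := is_derive_sinh t.
have dC := is_derive_cosh t.
have dV : is_derive t 1 (fun s : R => (sinh s)^-1) (- (sinh t) ^- 2 * cosh t).
  exact: is_deriveV.
set A := dot x x + dot y y; set B := 2 * dot x y.
have mehlerE s : N * mehler x s y = N * (2 * pi)^-1 * (sinh s)^-1 *
    expR (- 2^-1 * ((cosh s * A - B) * (sinh s)^-1)).
  rewrite /mehler -/A -/B !invfM !mulrA; congr (_ * expR _); ring.
have -> : (fun s => N * mehler x s y) = (fun s : R => N * (2 * pi)^-1 *
    (sinh s)^-1 * expR (- 2^-1 * ((cosh s * A - B) * (sinh s)^-1))).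
  by apply/funext => s; rewrite mehlerE.
have -> : laplacian ((fun x t => N * mehler x t y) ^~ t) x =
    (- 2 * cosh t / sinh t +
     ((y.1 - cosh t * x.1) ^+ 2 + (y.2 - cosh t * x.2) ^+ 2) / sinh t ^+ 2) *
    (N * mehler x t y).
  rewrite /laplacian.
  set f1 := (X in derive1n 2 X x.1); set f2 := (X in derive1n 2 X x.2).
  have -> : f1 = fun z => N * (2 * pi * sinh t)^-1 *
      expR ((- cosh t / (2 * sinh t)) * z ^+ 2 + (y.1 / sinh t) * z +
      (- (cosh t * (x.2 ^+ 2 + dot y y) - 2 * x.2 * y.2) / (2 * sinh t))).
    apply/funext => z; rewrite /f1 /mehler /dot/= mulrA; congr (_ * expR _).
    by field.
  have -> : f2 = fun z => N * (2 * pi * sinh t)^-1 *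
      expR ((- cosh t / (2 * sinh t)) * z ^+ 2 + (y.2 / sinh t) * z +
      (- (cosh t * (x.1 ^+ 2 + dot y y) - 2 * x.1 * y.1) / (2 * sinh t))).
    apply/funext => z; rewrite /f2 /mehler /dot/= mulrA; congr (_ * expR _).
    by field.
  rewrite !derive2_gauss /mehler.
  set e1 := expR (_ + _); set e2 := expR (_ + _); set e := expR _.
  have -> : e1 = e by rewrite /e1 /e; congr expR; rewrite /dot; field.
  have -> : e2 = e by rewrite /e2 /e; congr expR; rewrite /dot; field.
  by move: p0; set p := pi; clearbody p => p0; field; rewrite p0 S1.
apply: is_derive_eq.
rewrite mehlerE; set e := expR _.
rewrite /GRing.scale/=.
apply/eqP; rewrite -subr_eq0; apply/eqP.
transitivity ((1 + sinh t ^+ 2 - cosh t ^+ 2) *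
    (N * (2 * pi)^-1 * (sinh t)^-1 * e * (- dot y y / (2 * sinh t ^+ 2)))).
  rewrite /A /B /dot; move: p0; set p := pi; clearbody p => p0; field.
  by rewrite p0 S1.
by rewrite CS; ring.
Qed.

Lemma mehler_solves_backward N T y :
  solves_backward (fun x t => N * mehler x (T - t) y) [set t | t < T].
Proof.
move=> x t /= tT; have Tt0 : 0 < T - t by rewrite subr_gt0.
have dg := mehler_solves_forward N y x Tt0.
have dT : is_derive t 1 (fun s : R => T - s) (-1).
  by apply: is_derive_eq; rewrite add0r mul1r.
have := is_derive1_comp (f := fun s => N * mehler x s y)
  (g := fun s => T - s) dg dT.
by rewrite mulrN1.
Qed.

(* The solutions with data [N phi] at time 0 and [N psi] at time T, through
   the Green's function [mehler] of the system. *)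
Definition forward_sol (N : R) (phi : {measure set (plane R) -> \bar R})
    x t : R :=
  N * \int[phi]_y mehler x t y.

Definition backward_sol (T N : R) (psi : {measure set (plane R) -> \bar R})
    x t : R :=
  N * \int[psi]_y mehler x (T - t) y.

Lemma measurable_mehler x t : measurable_fun [set: plane R] (mehler x t).
Proof.
rewrite /mehler /dot; apply: measurable_funM => //.
apply: measurableT_comp => //; apply: measurableT_comp => //.
apply: measurable_funM => //.
apply: measurable_funB; apply: measurable_funM => //; by repeat first [apply: measurable_funD | apply: measurable_funM
                  |exact: measurable_fst|exact: measurable_snd|done].
Qed.

Lemma Rintegral_dirac_mehler x t y :
  \int[\d_y]_z mehler x t z = mehler x t y.
Proof.
rewrite /Rintegral integral_dirac//; last first.
  by apply/measurable_EFinP; exact: measurable_mehler.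
by rewrite diracT mul1e.
Qed.

Lemma forward_sol_dirac N y x t :
  forward_sol N \d_y x t = N * mehler x t y.
Proof. by rewrite /forward_sol Rintegral_dirac_mehler. Qed.

Lemma backward_sol_dirac T N y x t :
  backward_sol T N \d_y x t = N * mehler x (T - t) y.
Proof. by rewrite /backward_sol Rintegral_dirac_mehler. Qed.

Lemma forward_sol_dirac_solves T N y :
  solves_forward (forward_sol N \d_y) [set t | 0 < t <= T].
Proof.
move=> x t /= /andP[t0 _].
have -> : forward_sol N \d_y = fun x t => N * mehler x t y.
  by apply/funext => x'; apply/funext => t'; rewrite forward_sol_dirac.
exact: mehler_solves_forward.
Qed.

Lemma backward_sol_dirac_solves T N y :
  solves_backward (backward_sol T N \d_y) [set t | 0 <= t < T].
Proof.
move=> x t /= /andP[_ tT].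
have -> : backward_sol T N \d_y = fun x t => N * mehler x (T - t) y.
  by apply/funext => x'; apply/funext => t'; rewrite backward_sol_dirac.
exact: mehler_solves_backward.
Qed.

End System.

Notation delta0 R := \d_((0 : R, 0 : R) : plane R).

Section Bernstein.
Context {R : realType} {d : measure_display} {Omega : measurableType d}.
Variables (P : probability Omega R) (T : R) (Z : R -> Omega -> plane R).

(* [Y] is a version of the conditional expectation of [X] given the
   sub-sigma-algebra [G]. *)
Record is_condexp (G : set (set Omega)) (X Y : Omega -> R) : Prop := {
  condexp_measurable : forall B : set R, measurable B -> G (Y @^-1` B);
  condexp_integrable : P.-integrable setT (EFin \o Y);
  condexp_integral : forall A, G A ->
    (\int[P]_(w in A) (Y w)%:E = \int[P]_(w in A) (X w)%:E)%E
}.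

(* Almost sure equality of the conditional expectations of [X] given [G] and
   given [H]: versions being unique up to null sets, it says that some
   function is a version of both. *)
Definition same_condexp (G H : set (set Omega)) (X : Omega -> R) : Prop :=
  exists2 Y : Omega -> R, is_condexp G X Y & is_condexp H X Y.

Definition sigma_of (I : set R) : set (set Omega) :=
  <<s [set A | exists2 t, I t & exists2 B, measurable B & A = Z t @^-1` B] >>.

Definition past (s : R) : set (set Omega) := sigma_of [set t | 0 <= t <= s].
Definition future (t : R) : set (set Omega) := sigma_of [set s | t <= s <= T].

Definition bounded_borel (f : plane R -> R) : Prop :=
  measurable_fun setT f /\ exists M : R, forall x, `|f x| <= M.

Definition bernstein : Prop :=
  forall f, bounded_borel f -> forall s r t, 0 <= s -> s < r < t -> t <= T ->
  same_condexp <<s past s `|` future t >> (sigma_of [set s; t]) (f \o Z r).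

Definition markov : Prop :=
  forall f, bounded_borel f -> forall s t, 0 <= s -> s <= t -> t <= T ->
  same_condexp (past s) (sigma_of [set s]) (f \o Z t).

Variables (N : R) (phi psi : {measure set (plane R) -> \bar R}).
Let u := forward_sol N phi.
Let v := backward_sol T N psi.

Definition endpoint_law (A : set (plane R * plane R)) : \bar R :=
  ((N ^+ 2)%:E *
   \int[phi]_x \int[psi]_y (mehler x T y * \1_A (x, y))%:E)%E.

(* The integral of [h [:: x1; ...; xn]] over x1 in F1, then ..., xn in Fn. *)
Fixpoint iterated_integral (Fs : seq (set (plane R)))
    (h : seq (plane R) -> \bar R) : \bar R :=
  if Fs is F :: Fs' then
    (\int[leb2]_(x in F) iterated_integral Fs' (fun xs => h (x :: xs)))%E
  else h [::].

Definition path_density (ts : seq R) (xs : seq (plane R)) : R :=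
  let x k := nth (0, 0) xs k in
  let t k := nth 0 ts k in
  (\prod_(1 <= k < size ts) mehler (x k) (t k - t k.-1) (x k.-1)) *
  u (x 0%N) (t 0%N) * v (x (size ts).-1) (t (size ts).-1).

(* [Z] is the Markovian Bernstein process associated with the forward and
   backward equations with data [N phi] at time 0 and [N psi] at time [T]. *)
Record associated_bernstein : Prop := {
  process_measurable : forall t, 0 <= t <= T -> measurable_fun setT (Z t);
  process_bernstein : bernstein;
  process_markov : markov;
  joint_endpoint_law : forall A, measurable A ->
    P [set w | A (Z 0 w, Z T w)] = endpoint_law A;
  finite_dimensional_law : forall (ts : seq R) (Fs : seq (set (plane R))),
    (2 <= size ts)%N -> size Fs = size ts -> sorted <%R (0 :: rcons ts T) ->
    (forall k, (k < size Fs)%N -> measurable (nth set0 Fs k)) ->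
    P [set w | forall k, (k < size ts)%N ->
                 nth set0 Fs k (Z (nth 0 ts k) w)] =
    iterated_integral Fs (fun xs => (path_density ts xs)%:E);
  marginal_law : forall t F, 0 < t < T -> measurable F ->
    (P (Z t @^-1` F) = \int[leb2]_(x in F) (u x t * v x t)%:E)%E;
  initial_law : forall F, measurable F ->
    (P (Z 0 @^-1` F) = N%:E * \int[phi]_(x in F) (v x 0)%:E)%E;
  final_law : forall F, measurable F ->
    (P (Z T @^-1` F) = N%:E * \int[psi]_(x in F) (u x T)%:E)%E
}.

End Bernstein.

Definition rho {R : realType} (T t : R) : R := sinh t * sinh (T - t) / sinh T.

(* Main.v *)
(* The density of Z_t is u v = N^2 g(x, t, 0) g(x, T - t, 0). Since
   N^2 = 2 pi sinh T and coth t + coth (T - t) = 1 / rho(t), it is the centred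
   Gaussian density with variance rho(t) in each coordinate, so that
   P(r1 <= |Z_t| < r2) = exp(- r1^2 / (2 rho)) - exp(- r2^2 / (2 rho)).
   Now rho(t) = (cosh T - cosh (T - 2 t)) / (2 sinh T) is symmetric about T / 2,
   increasing before it, and smaller than 1 / 2. The mass of a disc decreases
   with rho, whereas exp(- a / rho) - exp(- b / rho) increases with rho as long
   as rho < a < b, which holds for a = r1^2 / 2 with r1 >= 1. *)
Require Import Defs.
From mathcomp Require Import all_boot all_order all_algebra.
From mathcomp Require Import all_classical all_reals all_analysis.
From mathcomp Require Import measurable_realfun ring lra.
Import Order.TTheory GRing.Theory Num.Theory.
Import numFieldNormedType.Exports.
Local Open Scope classical_set_scope.
Local Open Scope ring_scope.

Set Implicit Arguments.
Unset Strict Implicit.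

(** * Monotonicity and bounds for [rho] and for differences of exponentials *)

Section hyperbolic_exponential.
Context {R : realType}.
Implicit Types a b r s t T : R.

(** In this product-to-sum form, for fixed [T] the time enters [rho] only through
    [cosh (T - 2 * t)]; both the monotonicity of [rho] and its upper bound are read off from it. *)
Lemma sinh_mul_sinhB T t :
  sinh t * sinh (T - t) = (cosh T - cosh (T - 2 * t)) / 2.
Proof.
have -> : T - 2 * t = T - t - t by ring.
have -> : cosh T = cosh (T - t + t) by rewrite subrK.
by rewrite /sinh /cosh !opprD !expRD opprK; field.
Qed.

Lemma ltr_cosh s t : 0 <= s -> s < t -> cosh s < cosh t.
Proof.
move=> s0 st; rewrite /cosh ltr_pM2r ?invr_gt0// -subr_gt0.
have -> : expR t + expR (- t) - (expR s + expR (- s)) =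
    (expR t - expR s) * (1 - expR (- s - t)).
  have := expRxMexpNx_1 s; have := expRxMexpNx_1 t.
  by rewrite expRD; set x := expR t; set y := expR s => h k; ring: h k.
rewrite mulr_gt0// subr_gt0 ?ltr_expR// expR_lt1; lra.
Qed.

Lemma cosh_ge1 t : 1 <= cosh t.
Proof.
rewrite /cosh ler_pdivlMr// mul1r -subr_ge0.
have -> : expR t + expR (- t) - 2 = expR (- t) * (expR t - 1) ^+ 2.
  by have := expRxMexpNx_1 t; set x := expR t => h; ring: h.
by rewrite mulr_ge0// ?expR_ge0// sqr_ge0.
Qed.

Lemma rho_gt0 T t : 0 < t < T -> 0 < rho T t.
Proof.
move=> /andP[t0 tT]; have Tt0 : 0 < T - t by rewrite subr_gt0.
apply: divr_gt0; first by apply: mulr_gt0; exact: sinh_gt0.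
exact/sinh_gt0/(lt_trans t0).
Qed.

Lemma rho_sym T t : rho T (T - t) = rho T t.
Proof. by rewrite /rho subKr [sinh (T - t) * _]mulrC. Qed.

Lemma rho_increasing T s t : 0 < s -> s < t -> t <= T / 2 ->
  rho T s < rho T t.
Proof.
move=> s0 st tT; rewrite /rho ltr_pM2r; last first.
  by rewrite invr_gt0 sinh_gt0//; lra.
rewrite !sinh_mul_sinhB ltr_pM2r ?invr_gt0// ltrD2l ltrN2.
apply: ltr_cosh; lra.
Qed.

(** Since [cosh T - sinh T = expR (- T) < 1 <= cosh (T - 2 * t)], the numerator
    [cosh T - cosh (T - 2 * t)] stays below [sinh T]. *)
Lemma rho_lt_half T t : 0 < t < T -> rho T t < 2^-1.
Proof.
move=> /andP[t0 tT]; have T0 : 0 < T by exact: lt_trans t0 tT.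
rewrite /rho ltr_pdivrMr ?sinh_gt0//.
rewrite sinh_mul_sinhB mulrC ltr_pM2l ?invr_gt0//.
have c1 := cosh_ge1 (T - 2 * t).
have : cosh T - sinh T = expR (- T) by rewrite /cosh /sinh; field.
have : expR (- T) < 1 by rewrite expR_lt1; lra.
lra.
Qed.

(** Convexity of [expR] between [- (k * z)] and 0, with weight [k^-1] on the first point, whose
    barycentre is [- z]. This is Bernoulli's inequality for the power [k] of [expR (- z)]. *)
Lemma expR_Bernoulli (k z : R) : 1 <= k ->
  1 - expR (- (k * z)) <= k * (1 - expR (- z)).
Proof.
move=> k1; have k0 : 0 < k by exact: lt_le_trans k1.
have ki : 0 <= k^-1 <= 1 by rewrite invr_ge0 ltW//= invf_le1.
have := convex_expR (Itv01 (andP ki).1 (andP ki).2) (- (k * z)) 0.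
rewrite !convRE/= /unstable.onem expR0 mulr0 addr0 mulr1 mulrN mulKf ?gt_eqF//.
move=> h; rewrite -subr_ge0.
have -> : k * (1 - expR (- z)) - (1 - expR (- (k * z))) =
    k * (k^-1 * expR (- (k * z)) + (1 - k^-1) - expR (- z)).
  by field; rewrite gt_eqF.
by rewrite mulr_ge0 ?subr_ge0// ltW.
Qed.

Lemma expR_diff_increasing a b r s : 0 < r -> r < s -> s < a -> a < b ->
  expR (- (a / r)) - expR (- (b / r)) < expR (- (a / s)) - expR (- (b / s)).
Proof.
(* With z = a (1/r - 1/s) and k = b / a, Bernoulli's inequality bounds
   1 - exp (- k z) by k (1 - exp (- z)), and k < exp ((b - a) / s) as s < a. *)
move=> r0 rs sa ab.
have s0 : 0 < s by exact: lt_trans r0 rs.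
have a0 : 0 < a by exact: lt_trans s0 sa.
pose k := b / a; pose tau := s^-1; pose z := a * (r^-1 - tau).
have z0 : 0 < z by rewrite mulr_gt0// subr_gt0 ltf_pV2.
have k1 : 1 < k by rewrite ltr_pdivlMr// mul1r.
have ar : - (a / r) = - (a * tau) - z by rewrite /z; ring.
have br : - (b / r) = - (b * tau) - k * z.
  by rewrite /k /z; field; rewrite !gt_eqF.
have w : - (a * tau) = - (b * tau) + (b - a) * tau by ring.
have kw : k < expR ((b - a) * tau).
  apply: lt_le_trans (expR_ge1Dx _).
  have -> : k = 1 + (b - a) * a^-1 by rewrite /k; field; rewrite gt_eqF.
  by rewrite ltrD2l ltr_pM2l ?subr_gt0// ltf_pV2.
rewrite ar br -/tau w !expRD.
have B : 1 - expR (- (k * z)) <= k * (1 - expR (- z)).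
  exact/expR_Bernoulli/ltW.
have X0 : 0 < 1 - expR (- z) by rewrite subr_gt0 expR_lt1; lra.
have Q0 : 0 < expR (- (b * tau)) by exact: expR_gt0.
move: kw B X0 Q0.
set Q := expR (- (b * tau)); set W := expR (_ * tau).
set x := expR (- z); set y := expR (- (k * z)).
move=> kw B X0 Q0; rewrite -subr_gt0.
(* With the common factor [Q] taken out, what remains is the chain
   [1 - y <= k * (1 - x) < W * (1 - x)]. *)
have -> : Q * W - Q - (Q * W * x - Q * y) = Q * (W * (1 - x) - (1 - y)) by ring.
by rewrite mulr_gt0// subr_gt0 (le_lt_trans B)// ltr_pM2r.
Qed.

End hyperbolic_exponential.

(** * Scaling and reflection for Lebesgue integrals on the line *)

Section lebesgue_line.
Context {R : realType}.
Local Notation mu := (@lebesgue_measure R).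
Local Open Scope ereal_scope.

(** By uniqueness of Lebesgue measure it suffices to compare both sides on half-open intervals,
    whose preimages are again such intervals, shorter by the factor [a]. *)
Lemma lebesgue_measure_scale (a : R) (A : set R) : (0 < a)%R -> measurable A ->
  a%:E * pushforward mu (fun x : R => a * x : measurableTypeR R)%R A = mu A.
Proof.
move=> a0 mA.
have mphi : measurable_fun [set: measurableTypeR R]
    (fun x : R => a * x : measurableTypeR R)%R by exact: measurable_funM.
pose m := mscale (NngNum (ltW a0)) (pushforward mu
  (fun x : R => a * x : measurableTypeR R)%R).
apply/esym; rewrite -[RHS]/(m mphi A).
apply: (lebesgue_measure_unique (mu := m mphi)) => // _ [[x y]] _ <-.
change (mu `]x, y]%classic =
  a%:E * mu ((fun z : R => a * z)%R @^-1` `]x, y]%classic)).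
have -> : (fun z : R => a * z)%R @^-1` `]x, y] =
    `](a^-1 * x)%R, (a^-1 * y)%R]%classic.
  by apply/seteqP; split=> z /=; rewrite !in_itv/= ltr_pdivrMl// ler_pdivlMl.
rewrite !lebesgue_measure_itv/= !lte_fin ltr_pM2l ?invr_gt0//.
case: ifPn => _; last by rewrite mule0.
by rewrite -!EFinB -EFinM -mulrBr mulrA divff ?mul1r// gt_eqF.
Qed.

(** Obtained from measures rather than derivatives, so that [f] need only be measurable: the
    integrands to come are cut off by an indicator and may jump. *)
Lemma ge0_integral_scale (a : R) (f : R -> \bar R) : (0 < a)%R ->
  measurable_fun setT f -> (forall x, 0 <= f x) ->
  \int[mu]_x f x = a%:E * \int[mu]_x f (a * x)%R.
Proof.
move=> a0 mf f0.
have mphi : measurable_fun [set: measurableTypeR R]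
    (fun x : R => a * x : measurableTypeR R)%R by exact: measurable_funM.
pose m := mscale (NngNum (ltW a0)) (pushforward mu
  (fun x : R => a * x : measurableTypeR R)%R).
transitivity (\int[m mphi]_x f x).
  apply: eq_measure_integral => A mA _.
  exact/esym/(lebesgue_measure_scale a0).
rewrite ge0_integral_mscale//; congr (_ * _).
by rewrite ge0_integral_pushforward//= preimage_setT.
Qed.

Lemma ge0_even_integral (f : R -> \bar R) :
  measurable_fun setT f -> (forall x, 0 <= f x) ->
  (forall x, f (- x)%R = f x) ->
  \int[mu]_x f x = 2%:E * \int[mu]_(x in `[0%R, +oo[) f x.
Proof.
move=> mf f0 fN.
rewrite -(setUv (`[0%R, +oo[%classic : set R)) ge0_integral_setU//=.
- rewrite setCitvr.
  (* The negative half-line is closed at 0, a null set, so that reflection carries it onto the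
     closed half-line. *)
  rewrite integral_itv_bndo_bndc; last exact: measurable_funTS.
  rewrite mule_natl mule2n; congr +%E.
  rewrite ge0_integration_by_substitution0//.
  by apply: eq_integral => x _; rewrite fN.
- exact: measurableC.
- exact/measurable_funTS.
- exact/disj_setPCl.
Qed.

End lebesgue_line.

(** * Integrals of radial functions over the plane *)

Section polar.
Context {R : realType}.
Local Notation mu := (@lebesgue_measure R).
Local Open Scope ereal_scope.

Lemma measurable_oneDsqrV :
  measurable_fun [set: R] (fun t : R => (oneDsqr t)^-1)%R.
Proof. by have /continuous_measurable_fun := @continuous_oneDsqrV R. Qed.

Lemma integralT_oneDsqr : \int[mu]_t ((oneDsqr t)^-1)%:E = pi%:E.
Proof.
rewrite ge0_even_integral.
- by rewrite integral0y_oneDsqr -EFinM mulrCA divff// mulr1.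
- by apply/measurable_EFinP; exact: measurable_oneDsqrV.
- by move=> t; rewrite lee_fin invr_ge0 ltW.
- by move=> t; rewrite /oneDsqr sqrrN.
Qed.

(* Polar coordinates by one-dimensional scalings only: put y = |x| t in the
   inner integral, exchange the integrals, and put s = sqrt (1 + t^2) x; the
   factor pi is the integral of 1 / (1 + t^2). *)
Lemma ge0_integral_radial (f : R -> \bar R) :
  measurable_fun setT f -> (forall x, 0 <= f x) ->
  \int[leb2]_z f (z.1 ^+ 2 + z.2 ^+ 2)%R =
  pi%:E * \int[mu]_(r in `[0%R, +oo[) ((2 * r)%:E * f (r ^+ 2)%R).
Proof.
move=> mf f0.
have mh : measurable_fun [set: R] (fun s : R => `|s|%:E * f (s ^+ 2)%R).
  apply: emeasurable_funM; first exact/measurable_EFinP.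
  exact: measurableT_comp.
have h0 (s : R) : 0 <= `|s|%:E * f (s ^+ 2)%R by rewrite mule_ge0 ?lee_fin.
have mg : measurable_fun [set: plane R] (fun z : plane R =>
    f (z.1 ^+ 2 + z.2 ^+ 2)%R).
  apply: measurableT_comp => //; apply: measurable_funD.
  - exact: measurable_funX.
  - exact: measurable_funX.
have mk : measurable_fun [set: plane R] (fun z : plane R =>
    `|z.1|%:E * f (z.1 ^+ 2 * oneDsqr z.2)%R).
  apply: emeasurable_funM.
    by apply/measurable_EFinP; exact: measurableT_comp.
  apply: measurableT_comp => //; apply: measurable_funM.
    exact: measurable_funX.
  apply: measurable_funD => //.
  exact: measurable_funX.
have k0 (x t : R) : 0 <= `|x|%:E * f (x ^+ 2 * oneDsqr t)%R.
  by rewrite mule_ge0 ?lee_fin.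
rewrite (fubini_tonelli1 (fun z : plane R => f (z.1 ^+ 2 + z.2 ^+ 2)%R))//=.
transitivity (\int[mu]_x \int[mu]_t (`|x|%:E * f (x ^+ 2 * oneDsqr t)%R)).
  (* The null set where [x] is 0 is discarded on both sides, since the scaling by [|x|] needs a
     positive factor. *)
  transitivity (\int[mu]_(x in [set: R] `\ 0%R)
      \int[mu]_y f (x ^+ 2 + y ^+ 2)%R).
    apply/esym/integral_setD1; first exact: measurableD.
    apply: measurable_funTS.
    exact: (@measurable_fun_fubini_tonelli_F _ _ (measurableTypeR R)
      (measurableTypeR R) R mu _ mg (fun=> f0 _)).
  transitivity (\int[mu]_(x in [set: R] `\ 0%R)
      \int[mu]_t (`|x|%:E * f (x ^+ 2 * oneDsqr t)%R)); last first.
    apply: integral_setD1; first exact: measurableD.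
    apply: measurable_funTS.
    exact: (@measurable_fun_fubini_tonelli_F _ _ (measurableTypeR R)
      (measurableTypeR R) R mu _ mk (fun=> k0 _ _)).
  apply: eq_integral => x; rewrite inE => -[_ /= /eqP x0].
  have x0' : (0 < `|x|)%R by rewrite normr_gt0.
  rewrite (ge0_integral_scale (f := fun y => f (x ^+ 2 + y ^+ 2)%R) x0')//.
    rewrite -ge0_integralZl//.
      apply: eq_integral => t _; congr (_ * f _).
      by rewrite exprMn real_normK ?num_real// /oneDsqr mulrDr mulr1.
    apply: measurableT_comp => //; apply: measurable_funD => //.
    by apply: measurable_funX; exact: measurable_funM.
  by apply: measurableT_comp => //; exact: measurable_funD.
rewrite (fubini_tonelli (fun z : plane R =>
  `|z.1|%:E * f (z.1 ^+ 2 * oneDsqr z.2)%R))//=.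
transitivity (\int[mu]_t (((oneDsqr t)^-1)%:E *
    \int[mu]_s (`|s|%:E * f (s ^+ 2)%R))).
  apply: eq_integral => t _.
  (* One factor [a^-1] comes from the Lebesgue measure and another from [|x|]; together they give
     the weight [(oneDsqr t)^-1], and the integral over [s] no longer depends on [t]. *)
  pose a := Num.sqrt (oneDsqr t).
  have a0 : (0 < a)%R by rewrite sqrtr_gt0.
  have aE : oneDsqr t = (a ^+ 2)%R by rewrite sqr_sqrtr// ltW.
  rewrite (ge0_integral_scale a0 mh)// muleA -EFinM -ge0_integralZl//.
  - apply: eq_integral => x _.
    rewrite normrM (gtr0_norm a0) exprMn muleA -EFinM aE.
    congr (_%:E * f _); last by rewrite mulrC.
    by field; rewrite gt_eqF.
  - apply: emeasurable_funM.
      by apply/measurable_EFinP; exact: measurableT_comp.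
    apply: measurableT_comp => //.
    by apply: measurable_funX; exact: measurable_funM.
  - by rewrite lee_fin mulr_ge0// ?invr_ge0 ltW.
rewrite ge0_integralZr//.
- rewrite integralT_oneDsqr; congr (_ * _).
  rewrite ge0_even_integral//.
  + rewrite -ge0_integralZl//.
    * apply: eq_integral => x; rewrite inE/= in_itv/= andbT => x0.
      by rewrite ger0_norm// muleA -EFinM.
    * exact: measurable_funTS.
  + by move=> x; rewrite normrN sqrrN.
- by apply/measurable_EFinP; exact: measurable_oneDsqrV.
- exact: integral_ge0.
Qed.

End polar.

(** * Gaussian integrals over annuli *)

Section disc.
Context {R : realType}.
Local Notation mu := (@lebesgue_measure R).

(** Squaring preserves order on nonnegative numbers. This form yields measurability and makes the
    indicator of the annulus a function of the squared radius, as [ge0_integral_radial] requires. *)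
Lemma annulusE (r1 r2 : R) : 0 <= r1 -> 0 <= r2 ->
  annulus r1 r2 =
  (fun z : plane R => z.1 ^+ 2 + z.2 ^+ 2) @^-1` `[r1 ^+ 2, r2 ^+ 2[.
Proof.
move=> r10 r20; apply/seteqP; suff H z : annulus r1 r2 z <->
    (z.1 ^+ 2 + z.2 ^+ 2) \in `[r1 ^+ 2, r2 ^+ 2[ by split=> z /H.
rewrite /annulus /enorm /dot/= in_itv/= -!expr2.
set s := _ + _; have s0 : 0 <= s by rewrite addr_ge0 ?sqr_ge0.
have := sqr_sqrtr s0; set q := Num.sqrt s => <-.
have q0 : 0 <= q := sqrtr_ge0 s.
rewrite ler_pXn2r ?nnegrE// ltr_pXn2r ?nnegrE//.
by split=> [[-> ->]|/andP].
Qed.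

Lemma measurable_annulus (r1 r2 : R) : 0 <= r1 -> 0 <= r2 ->
  measurable (annulus r1 r2).
Proof.
move=> r10 r20; rewrite annulusE// -[X in measurable X]setTI.
have mf : measurable_fun [set: plane R] (fun z : plane R => z.1 ^+ 2 + z.2 ^+ 2).
  by apply: measurable_funD; exact: measurable_funX.
exact: mf.
Qed.

Lemma integral_annulus_radial (r1 r2 c : R) : 0 <= r1 -> r1 < r2 -> 0 < c ->
  (\int[mu]_(x in `[r1, r2]) (2 * x * expR (- (c * x ^+ 2)))%:E =
   (c^-1 * (expR (- (c * r1 ^+ 2)) - expR (- (c * r2 ^+ 2))))%:E)%E.
Proof.
move=> r10 r12 c0.
pose F (x : R) := - c^-1 * expR (- (c * x ^+ 2)).
have dF (x : R) : is_derive x 1 F (2 * x * expR (- (c * x ^+ 2))).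
  apply: is_derive_eq.
  by rewrite /GRing.scale/=; field; rewrite gt_eqF.
have cF : continuous F.
  by move=> x; apply/differentiable_continuous/derivable1_diffP.
rewrite (@continuous_FTC2 _ _ F)//.
- by rewrite -EFinB /F; congr EFin; ring.
- apply: continuous_subspaceT => x.
  apply: continuousM.
    by apply: continuousM; [exact: cst_continuous|].
  apply: continuous_comp; last exact: continuous_expR.
  apply: continuousN; apply: continuousM; first exact: cst_continuous.
  exact: exprn_continuous.
- split => //.
  + by apply: cvg_at_right_filter; exact: cF.
  + by apply: cvg_at_left_filter; exact: cF.
- by move=> x _; rewrite derive1E; exact: derive_val.
Qed.

Lemma integral_annulus_gauss (r1 r2 c : R) : 0 <= r1 -> r1 < r2 -> 0 < c ->
  (\int[leb2]_(z in annulus r1 r2) (expR (- (c * dot z z)))%:E =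
   (pi / c * (expR (- (c * r1 ^+ 2)) - expR (- (c * r2 ^+ 2))))%:E)%E.
Proof.
move=> r10 r12 c0; have r20 : 0 <= r2 by rewrite (le_trans r10)// ltW.
(* The cut-off is absorbed into [f], a function of the squared radius, hence the squared bounds. *)
pose f := (fun s : R => (expR (- (c * s)))%:E) \_ `[r1 ^+ 2, r2 ^+ 2[.
have mf : measurable_fun setT f.
  apply/(measurable_restrictT _ _).1 => //.
  apply/measurable_EFinP; apply: measurable_funTS; apply: measurableT_comp => //.
  by apply: measurableT_comp => //; exact: measurable_funM.
have f0 s : (0 <= f s)%E.
  by rewrite /f patchE; case: ifPn => // _; rewrite lee_fin expR_ge0.
rewrite integral_mkcond.
transitivity (\int[leb2]_z f (z.1 ^+ 2 + z.2 ^+ 2)%R)%E.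
  by apply: eq_integral => z _; rewrite /f !patchE annulusE.
rewrite ge0_integral_radial//.
transitivity (pi%:E * \int[mu]_(x in `[r1, r2[)
    (2 * x * expR (- (c * x ^+ 2)))%:E)%E; last first.
  (* The endpoint [r2] is added at no cost, the fundamental theorem of calculus being applied on a
     closed interval. *)
  rewrite integral_itv_bndo_bndc.
    by rewrite integral_annulus_radial// -EFinM mulrA.
  apply/measurable_EFinP; apply: measurable_funTS; apply: measurable_funM.
    exact: measurable_funM.
  apply: measurableT_comp => //; apply: measurableT_comp => //.
  by apply: measurable_funM => //; exact: measurable_funX.
congr (_ * _)%E; rewrite [LHS]integral_mkcond [RHS]integral_mkcond.
apply: eq_integral => x _; rewrite /f !patchE !mem_setE !in_itv/= andbT.
(* For nonnegative [x] the bounds on [x ^+ 2] amount to bounds on [x]; for negative [x] both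
   restrictions vanish because [r1] is nonnegative. *)
have [x0|x0] := leP 0 x.
  rewrite ler_pXn2r ?nnegrE// ltr_pXn2r ?nnegrE//.
  by case: ifPn; rewrite ?mule0.
by rewrite [r1 <= x]leNgt (lt_le_trans x0).
Qed.

End disc.

(** * Normalization, one-time densities and endpoint laws *)

Section law.
Context {R : realType}.
Implicit Types (x y : plane R) (r t T N : R).

Lemma dotC x y : dot x y = dot y x.
Proof. by rewrite /dot [x.1 * _]mulrC [x.2 * _]mulrC. Qed.

Lemma measurable_dot : measurable_fun [set: plane R] (fun x => dot x x).
Proof.
rewrite /dot; under eq_fun do rewrite -!expr2.
by apply: measurable_funD; exact: measurable_funX.
Qed.

Lemma mehler_sym x t y : mehler x t y = mehler y t x.
Proof. by rewrite /mehler (dotC x y) [dot x x + _]addrC. Qed.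

Lemma mehler_origin x t :
  mehler x t (0, 0) =
  (2 * pi * sinh t)^-1 * expR (- (cosh t * dot x x / (2 * sinh t))).
Proof. by rewrite /mehler /dot/= !mulr0 !addr0 mulr0 subr0. Qed.

Lemma endpoint_law_diracE T N : 0 < T ->
  endpoint_law T N (delta0 R) (delta0 R) setT = (N ^+ 2 / (2 * pi * sinh T))%:E.
Proof.
move=> T0; rewrite /endpoint_law [RHS]EFinM; congr (_ * _)%E.
have innerE x : (\int[delta0 R]_y (mehler x T y * \1_setT (x, y))%:E)%E =
    (mehler x T (0, 0))%:E.
  under eq_integral do rewrite indicT mulr1.
  rewrite integral_dirac//; last first.
    by apply/measurable_EFinP; exact: measurable_mehler.
  by rewrite diracT mul1e.
under eq_integral do rewrite innerE.
(* Symmetry moves the integration variable to the last argument, the one in which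
   [measurable_mehler] gives measurability. *)
under eq_integral do rewrite mehler_sym.
rewrite integral_dirac//; last first.
  by apply/measurable_EFinP; exact: measurable_mehler.
rewrite diracT mul1e mehler_origin /dot/= !mulr0 addr0 mulr0 mul0r oppr0.
by rewrite expR0 mulr1.
Qed.

Lemma endpoint_law_normalization T N : 0 < T ->
  endpoint_law T N (delta0 R) (delta0 R) setT = 1%E ->
  N ^+ 2 = 2 * pi * sinh T.
Proof.
move=> T0; rewrite endpoint_law_diracE// => -[].
have pS : 0 < 2 * pi * sinh T :> R.
  by apply: mulr_gt0; [rewrite mulr_gt0// pi_gt0|exact: sinh_gt0].
by move/(canRL (divfK (lt0r_neq0 pS))); rewrite mul1r.
Qed.

Lemma density_dirac T N x t : 0 < t < T -> N ^+ 2 = 2 * pi * sinh T ->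
  forward_sol N (delta0 R) x t * backward_sol T N (delta0 R) x t =
  (2 * pi * rho T t)^-1 * expR (- ((2 * rho T t)^-1 * dot x x)).
Proof.
move=> /andP[t0 tT] NE; rewrite forward_sol_dirac backward_sol_dirac.
have T0 : 0 < T := lt_trans t0 tT.
have St : 0 < sinh t by exact: sinh_gt0.
have ST : 0 < sinh T by exact: sinh_gt0.
have SB : 0 < sinh (T - t) by apply: sinh_gt0; rewrite subr_gt0.
have p0 := pi_gt0 R.
(* Divided by [sinh t * sinh (T - t)], this addition formula says that the two hyperbolic cotangents
   in the exponents sum to the inverse of [rho T t]. *)
have STE : sinh T = cosh t * sinh (T - t) + cosh (T - t) * sinh t.
  have -> : sinh T = sinh (T - t + t) by rewrite subrK.
  by rewrite /sinh /cosh !opprD opprK !expRD; field.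
rewrite !mehler_origin mulrACA -expr2 NE [X in _ * X]mulrACA -expRD mulrA /rho.
(* From here the hyperbolic values become independent variables tied only by [STE], which leaves
   rational identities for [field]. *)
move: p0 St SB ST STE => /lt0r_neq0 + /lt0r_neq0 + /lt0r_neq0 + /lt0r_neq0.
set p := pi; set s := sinh t; set s' := sinh (T - t); set S := sinh T.
move: (cosh t) (cosh (T - t)); clearbody p s s' S.
move=> c c' p0 s0 s'0 S0 STE; congr (_ * expR _).
  by field; rewrite p0 s0 s'0 S0.
transitivity (- (S / (2 * s * s') * dot x x)); last first.
  by field; rewrite s0 s'0 S0.
by rewrite STE; field; rewrite s0 s'0.
Qed.

Context {d : measure_display} {Omega : measurableType d}.
Variables (P : probability Omega R) (T N : R) (Z : R -> Omega -> plane R).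
Hypotheses (T0 : 0 < T) (NE : N ^+ 2 = 2 * pi * sinh T)
  (ZP : associated_bernstein P T Z N (delta0 R) (delta0 R)).

Lemma bernstein_annulus t r1 r2 : 0 < t < T -> 0 <= r1 -> r1 < r2 ->
  P (Z t @^-1` annulus r1 r2) =
  (expR (- (r1 ^+ 2 / (2 * rho T t))) - expR (- (r2 ^+ 2 / (2 * rho T t))))%:E.
Proof.
move=> tT r10 r12; have r20 : 0 <= r2 by rewrite (le_trans r10)// ltW.
have rh := rho_gt0 tT; have p0 := pi_gt0 R.
rewrite (marginal_law ZP)//; last exact: measurable_annulus.
under eq_integral do rewrite density_dirac// EFinM.
rewrite ge0_integralZl//; last 3 first.
- exact: measurable_annulus.
- apply/measurable_EFinP; apply: measurable_funTS; apply: measurableT_comp => //.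
  apply: measurableT_comp => //; apply: measurable_funM => //.
  exact: measurable_dot.
- by rewrite lee_fin invr_ge0 ltW//; apply: mulr_gt0 => //; exact: mulr_gt0.
rewrite integral_annulus_gauss//; last by rewrite invr_gt0 mulr_gt0.
rewrite -EFinM mulrA; congr (_%:E).
rewrite -![(2 * rho T t)^-1 * _]mulrC.
(* The factor [pi / c] of the annulus integral, at [c = (2 * rho T t)^-1], cancels the prefactor of
   the density. *)
rewrite (_ : _ * (pi / _) = 1) ?mul1r//.
move: p0 => /lt0r_neq0; set p := pi; clearbody p => p0; field.
by rewrite p0 lt0r_neq0.
Qed.

(** The normalization in the shape left by integrating against the Dirac measure over a set; [b]
    records whether the set contains the origin. *)
Lemma mehler_normalized (b : bool) :
  (N%:E * ((b%:R)%:E * (N * mehler (0, 0) T (0, 0))%:E) = (b%:R)%:E :> \bar R)%E.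
Proof.
have pS : 0 < 2 * pi * sinh T :> R.
  by apply: mulr_gt0; [rewrite mulr_gt0// pi_gt0|exact: sinh_gt0].
have NM : N * (N * mehler (0, 0) T (0, 0)) = 1.
  rewrite mulrA -expr2 NE mehler_origin /dot/= !mulr0 addr0 mulr0 mul0r oppr0.
  by rewrite expR0 mulr1 divff// lt0r_neq0.
by rewrite -!EFinM mulrCA NM mulr1.
Qed.

(** The Gaussian formula covers interior times only. At the ends the process is pinned at the
    origin, and the normalization makes the mass there 1. *)
Lemma bernstein_start F : measurable F -> P (Z 0 @^-1` F) = (\1_F (0, 0))%:E.
Proof.
move=> mF; rewrite (initial_law ZP)//.
under eq_integral do rewrite backward_sol_dirac subr0 mehler_sym.
rewrite integral_dirac//; last first.
  apply/measurable_EFinP; apply: measurable_funTS; apply: measurable_funM => //.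
  exact: measurable_mehler.
by rewrite diracE mehler_normalized indicE.
Qed.

Lemma bernstein_end F : measurable F -> P (Z T @^-1` F) = (\1_F (0, 0))%:E.
Proof.
move=> mF; rewrite (final_law ZP)//.
under eq_integral do rewrite forward_sol_dirac mehler_sym.
rewrite integral_dirac//; last first.
  apply/measurable_EFinP; apply: measurable_funTS; apply: measurable_funM => //.
  exact: measurable_mehler.
by rewrite diracE mehler_normalized indicE.
Qed.

End law.

(** The reflection of [t] into [T - t] swaps the two halves and reverses order, so behaviour on the
    first half determines the rest. It serves the disc with [p] itself and the annulus with its
    opposite. *)
Lemma symmetric_decreasing (R : realType) (T : R) (p : R -> \bar R) :
  (forall t, 0 <= t <= T -> p (T - t) = p t) ->
  (forall s t, 0 <= s -> s < t -> t <= T / 2 -> (p t < p s)%E) ->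
  (forall s t, T / 2 <= s -> s < t -> t <= T -> (p s < p t)%E) /\
  (forall t, 0 <= t <= T -> (p (T / 2)%R <= p t)%E).
Proof.
move=> pT pdecr; split.
  move=> s t Ts st tT; have hs : 0 <= s <= T by lra.
  have ht : 0 <= t <= T by lra.
  by rewrite -(pT s)// -(pT t)//; apply: pdecr; lra.
suff half t : 0 <= t -> t <= T / 2 -> (p (T / 2)%R <= p t)%E.
  move=> t tT; have [tT2|tT2] := leP t (T / 2); first by apply: half => //; lra.
  by rewrite -(pT t)//; apply: half; lra.
move=> t0; rewrite le_eqVlt => /predU1P[->//|tT].
by apply/ltW/pdecr => //; exact: lexx.
Qed.

(** * Monotonicity in time of the mass of discs and annuli *)

Section radial_law.
Context {R : realType} {d : measure_display} {Omega : measurableType d}.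
Variables (P : probability Omega R) (T N : R) (Z : R -> Omega -> plane R).
Hypotheses (T0 : 0 < T) (NE : N ^+ 2 = 2 * pi * sinh T)
  (ZP : associated_bernstein P T Z N (delta0 R) (delta0 R)).

Lemma bernstein_annulus_sym (r1 r2 t : R) : 0 <= r1 -> r1 < r2 -> 0 <= t <= T ->
  P (Z (T - t) @^-1` annulus r1 r2) = P (Z t @^-1` annulus r1 r2).
Proof.
move=> r10 r12; have mA := measurable_annulus r10 (ltW (le_lt_trans r10 r12)).
have start := bernstein_start T0 NE ZP mA.
have fin := bernstein_end T0 NE ZP mA.
case/andP; rewrite le_eqVlt => /predU1P[<- _|t0].
  by rewrite subr0 start fin.
rewrite le_eqVlt => /predU1P[->|tT]; first by rewrite subrr start fin.
have tT' : 0 < t < T by lra.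
have stT : 0 < T - t < T by lra.
by rewrite !(bernstein_annulus NE ZP)// rho_sym.
Qed.

Lemma enorm0 : enorm ((0, 0) : plane R) = 0.
Proof. by rewrite /enorm /dot/= mulr0 addr0 sqrtr0. Qed.

Lemma bernstein_disc_endpoints (r : R) : 0 < r ->
  P (Z 0 @^-1` annulus 0 r) = 1%E /\ P (Z T @^-1` annulus 0 r) = 1%E.
Proof.
move=> r0; have mA := measurable_annulus (lexx 0) (ltW r0).
rewrite (bernstein_start T0 NE ZP)// (bernstein_end T0 NE ZP)//.
by rewrite indicE mem_set// /annulus/= enorm0.
Qed.

Lemma bernstein_annulus_endpoints (r1 r2 : R) : 0 < r1 -> r1 < r2 ->
  P (Z 0 @^-1` annulus r1 r2) = 0%E /\ P (Z T @^-1` annulus r1 r2) = 0%E.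
Proof.
move=> r10 r12.
have mA := measurable_annulus (ltW r10) (ltW (lt_trans r10 r12)).
rewrite (bernstein_start T0 NE ZP)// (bernstein_end T0 NE ZP)//.
by rewrite indicE memNset// /annulus/= enorm0 leNgt r10 => -[].
Qed.

Lemma bernstein_disc (r t : R) : 0 < r -> 0 < t < T ->
  P (Z t @^-1` annulus 0 r) = (1 - expR (- (r ^+ 2 / (2 * rho T t))))%:E.
Proof.
move=> r0 tT; rewrite (bernstein_annulus NE ZP)//.
by rewrite expr0n/= mul0r oppr0 expR0.
Qed.

Lemma bernstein_disc_decreasing (r s t : R) : 0 < r ->
  0 <= s -> s < t -> t <= T / 2 ->
  (P (Z t @^-1` annulus 0 r) < P (Z s @^-1` annulus 0 r))%E.
Proof.
(* Time 0 lies outside the Gaussian formula; there the mass is 1, which exceeds the mass at [t] by a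
   positive exponential. *)
move=> r0; rewrite le_eqVlt => /predU1P[<-|s0] st tT2.
  rewrite (bernstein_disc_endpoints r0).1 bernstein_disc//; last by lra.
  by rewrite lte_fin gtrBl expR_gt0.
have sT : 0 < s < T by lra.
rewrite !bernstein_disc//; last by lra.
have rs := rho_gt0 sT; have rst := rho_increasing s0 st tT2.
have rt := lt_trans rs rst.
rewrite lte_fin ltrD2l ltrN2 ltr_expR ltrN2 ltr_pM2l ?exprn_gt0//.
by rewrite ltf_pV2 ?posrE ?ltr_pM2l//; exact: mulr_gt0.
Qed.

Lemma bernstein_annulus_increasing (r1 r2 s t : R) : 1 <= r1 -> r1 < r2 ->
  0 <= s -> s < t -> t <= T / 2 ->
  (P (Z s @^-1` annulus r1 r2) < P (Z t @^-1` annulus r1 r2))%E.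
Proof.
move=> r11 r12 + st tT2; have r10 : 0 < r1 by lra.
have r10' := ltW r10.
have tT : 0 <= s -> 0 < t < T by lra.
have r2s : r1 ^+ 2 < r2 ^+ 2 by rewrite ltr_pXn2r ?nnegrE//; lra.
(* This isolates [r1 ^+ 2 / 2] and [r2 ^+ 2 / 2] as the constants [a] and [b] of
   [expR_diff_increasing]. *)
have E r u : r ^+ 2 / (2 * rho T u) = r ^+ 2 / 2 / rho T u.
  by rewrite invfM mulrA.
rewrite le_eqVlt => /predU1P[s0|s0].
  move: tT; rewrite -{}s0 lexx => /(_ isT) tT.
  rewrite (bernstein_annulus_endpoints r10 r12).1.
  rewrite (bernstein_annulus NE ZP)// lte_fin subr_gt0 ltr_expR ltrN2.
  by rewrite !E ltr_pM2r ?invr_gt0 ?ltr_pM2r//; exact: rho_gt0.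
have sT : 0 < s < T by lra.
move: tT => /(_ (ltW s0)) tT.
rewrite !(bernstein_annulus NE ZP)// lte_fin !E.
apply: expR_diff_increasing.
- exact: rho_gt0.
- exact: rho_increasing.
(* Here the assumption [1 <= r1] enters: it puts [r1 ^+ 2 / 2] at or above 1/2, hence above
   [rho T t]. *)
- apply: lt_le_trans (rho_lt_half tT) _.
  by rewrite -[leLHS]mul1r ler_pM2r// exprn_ege1.
- by rewrite ltr_pM2r.
Qed.

End radial_law.

Theorem proposition3 (R : realType) (T N : R) (d : measure_display)
    (Omega : measurableType d) (P : probability Omega R)
    (Z : R -> Omega -> plane R) :
  0 < T -> 0 < N ->
  endpoint_law T N (delta0 R) (delta0 R) setT = 1%E ->
  associated_bernstein P T Z N (delta0 R) (delta0 R) ->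
  (forall R2 : R, 0 < R2 ->
    let p := fun t : R => P (Z t @^-1` annulus 0 R2) in
    [/\ p 0 = 1%E /\ p T = 1%E,
        forall s t : R, 0 <= s -> s < t -> t <= T / 2 -> (p t < p s)%E,
        forall s t : R, T / 2 <= s -> s < t -> t <= T -> (p s < p t)%E,
        forall t : R, 0 <= t <= T -> (p (T / 2)%R <= p t)%E
      & p (T / 2) = (1 - expR (- (R2 ^+ 2 / (2 * rho T (T / 2)))))%:E]) /\
  (forall R1 R2 : R, 1 <= R1 -> R1 < R2 ->
    let p := fun t : R => P (Z t @^-1` annulus R1 R2) in
    [/\ p 0 = 0%E /\ p T = 0%E,
        forall s t : R, 0 <= s -> s < t -> t <= T / 2 -> (p s < p t)%E,
        forall s t : R, T / 2 <= s -> s < t -> t <= T -> (p t < p s)%E,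
        forall t : R, 0 <= t <= T -> (p t <= p (T / 2)%R)%E
      & p (T / 2) = (expR (- (R1 ^+ 2 / (2 * rho T (T / 2)))) -
                     expR (- (R2 ^+ 2 / (2 * rho T (T / 2)))))%:E]).
Proof.
move=> T0 _ norm ZP.
have NE := endpoint_law_normalization T0 norm.
have T2 : 0 < T / 2 < T by lra.
split=> [R2 R20 p|R1 R2 R11 R12 p].
  have pdecr s t := bernstein_disc_decreasing T0 NE ZP (s := s) (t := t) R20.
  have [pincr pmin] := symmetric_decreasing (T := T) (p := p)
    (fun t => bernstein_annulus_sym T0 NE ZP (lexx 0) R20 (t := t)) pdecr.
  split => //; first exact: (bernstein_disc_endpoints T0 NE ZP R20).
  exact: (bernstein_disc NE ZP R20 T2).
have R10 : 0 < R1 by lra.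
have pincr s t := bernstein_annulus_increasing T0 NE ZP (s := s) (t := t) R11 R12.
(* The sign change turns the increase of [p] on the first half into the decrease required, and the
   resulting minimum into a maximum. *)
have [||pdecr pmax] := symmetric_decreasing (T := T) (p := fun t => - p t)%E.
- move=> t tT; congr (- _)%E.
  exact: (bernstein_annulus_sym T0 NE ZP (ltW R10) R12 tT).
- by move=> s t s0 st tT; rewrite lteN2; exact: pincr.
split => //.
- exact: (bernstein_annulus_endpoints T0 NE ZP R10 R12).
- by move=> s t Ts st tT; rewrite -lteN2; exact: pdecr.
- by move=> t tT; rewrite -leeN2; exact: pmax.
- exact: (bernstein_annulus NE ZP T2 (ltW R10) R12).
Qed.
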